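(* Let $s\ge 1$ and let $X=\{a_1,\ldots,a_N\}$ be a finite multiset of nonzero vectors in $\mathbf{Z}^s$ which spans $\mathbf{R}^s$ and is such that the equation $\sum_{i=1}^N x_i a_i=0$ has no nonzero solution $(x_1,\ldots,x_N)$ with all $x_i\in\mathbf{R}_+$. Then the discrete truncated power $t_X:\mathbf{Z}^s\to\mathbf{N}$ is a finite sum of periodic piecewise polynomials on shifted sublattice cones of $\Lambda_X^+$. That is, there are finitely many functions $f_1,\ldots,f_r:\mathbf{Z}^s\to\mathbf{R}$ with $t_X=f_1+\cdots+f_r$ on $\mathbf{Z}^s$ such that, for each $j$, there are a linearly independent set $A_j$ of $s$ vectors in $\widetilde{X}$, a vector $c_j\in\mathbf{Z}^s$ and a real polynomial $p_j$ in $s$ variables with $f_j(x)=p_j(x)$ for $x\in\Lambda_{A_j}^+(c_j)$ and $f_j(x)=0$ for $x\in\mathbf{Z}^s\setminus\Lambda_{A_j}^+(c_j)$.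
   Context: $\mathbf{N}$ denotes the nonnegative integers and $\mathbf{R}_+$ the nonnegative reals. For a finite multiset $X=\{a_1,\ldots,a_N\}$ as in the claim (repeated vectors are allowed and counted with multiplicity), the discrete truncated power (partition function) is $t_X(x)=\#\{\beta=(\beta_1,\ldots,\beta_N)\in\mathbf{N}^N : \sum_{i=1}^N\beta_i a_i=x\}$ for $x\in\mathbf{Z}^s$; it is finite under the stated hypothesis. $\widetilde{X}=\{na : a\in X,\ n\in\mathbf{N}\}$ is the set of nonnegative integer multiples of vectors in $X$. For a finite set or multiset $Y$ of vectors in $\mathbf{Z}^s$, the lattice cone is $\Lambda_Y^+=\{\sum_{a\in Y}\alpha_a a : \alpha_a\in\mathbf{N}\}$ and its shift by $c$ is $\Lambda_Y^+(c)=\{c+\sum_{a\in Y}\alpha_a a : \alpha_a\in\mathbf{N}\}$. If $A\subset\widetilde{X}$ is linearly independent with $s$ elements, then $\Lambda_A^+\subset\Lambda_X^+$ is a sublattice cone of $\Lambda_X^+$, and $\Lambda_A^+(c)$ is a shifted sublattice cone. *)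

(* Defs.v *)
From mathcomp Require Import all_boot all_order all_algebra.
From mathcomp Require Import finmap.
From mathcomp Require Import boolp classical_sets functions cardinality reals.
From mathcomp Require Import mpoly.

Set Implicit Arguments.
Unset Strict Implicit.
Unset Printing Implicit Defensive.

Import Order.TTheory GRing.Theory Num.Theory.

Local Open Scope classical_set_scope.
Local Open Scope ring_scope.

(* Multisets of vectors are tuples, so repeated vectors occur at several
   indices and are counted with multiplicity. *)

Definition real_vec (R : realType) (s : nat) (v : 'rV[int]_s) : 'rV[R]_s :=
  map_mx intr v.

Definition solutions (s N : nat) (X : N.-tuple 'rV[int]_s) (x : 'rV[int]_s) :
    set {ffun 'I_N -> nat} :=
  [set beta | \sum_(i < N) tnth X i *+ beta i = x].

(* fset_set returns the empty set on an infinite set, hence the value is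
   meaningful only when there are finitely many solutions; this is the case when
   0 is not a nontrivial nonnegative real combination of X. *)
Definition truncated_power (s N : nat) (X : N.-tuple 'rV[int]_s)
    (x : 'rV[int]_s) : nat :=
  #|` fset_set (solutions X x)|.

Definition nat_multiples (s N : nat) (X : N.-tuple 'rV[int]_s) :
    set 'rV[int]_s :=
  [set v | exists2 a, a \in X & exists n : nat, v = a *+ n].

Definition shifted_cone (s m : nat) (Y : m.-tuple 'rV[int]_s)
    (c : 'rV[int]_s) : set 'rV[int]_s :=
  [set x | exists alpha : 'I_m -> nat,
             x = c + \sum_(i < m) tnth Y i *+ alpha i].

Definition int_eval (R : realType) (s : nat) (p : {mpoly R[s]})
    (x : 'rV[int]_s) : R :=
  p.@[fun i => (x 0 i)%:~R].

(* A set of s linearly independent vectors is enumerated by an s-tuple; freeness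
   makes its entries pairwise distinct. *)
Definition poly_on_shifted_sublattice_cone (R : realType) (s N : nat)
    (X : N.-tuple 'rV[int]_s) (f : 'rV[int]_s -> R) : Prop :=
  exists (A : s.-tuple 'rV[int]_s) (c : 'rV[int]_s) (p : {mpoly R[s]}),
    [/\ forall v, v \in A -> nat_multiples X v,
        free [seq real_vec R v | v <- A],
        forall x, shifted_cone A c x -> f x = int_eval p x &
        forall x, ~ shifted_cone A c x -> f x = 0].

(* Main.v *)
Require Import Defs.
From mathcomp Require Import all_boot all_order all_algebra.
From mathcomp Require Import fingroup perm finmap.
From mathcomp Require Import boolp classical_sets functions cardinality.
From mathcomp Require Import reals mpoly.

Set Implicit Arguments.
Unset Strict Implicit.
Unset Printing Implicit Defensive.

Import Order.TTheory GRing.Theory Num.Theory.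
Local Open Scope ring_scope.

(** Write [t_Y] for the partition function of a list [Y] of nonzero multiples of
    vectors of [X], and [D_u f x = f x - f (x - u)].  Splitting the solutions
    by whether the coefficient of the head vanishes gives
    [D_v t_(v :: Y) = t_Y] (lemma [partition_count_cons]); in the language of
    generating functions, multiplying the series by [1 - z^v] removes one factor
    [1 / (1 - z^v)].

    The functions of the desired form are closed under sums, opposites and
    translations.  Hence, for a fixed [f], the vectors [u] for which [D_u f] has
    the desired form make up a subgroup of the lattice, because
    [D_(u + v) f = D_u f + (D_v f)(. - u)].  Applied to [f = t_(u :: Y)], for
    which [D_u f = t_Y], this is the partial fraction step of the proof (lemma
    [exchange]): if [u] is an integer combination of members [v] of [Y], then
    [t_Y] has the desired form as soon as each [t_(u :: Y - v)] does, where one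
    copy of [v] has been traded for a copy of [u].

    If the distinct members of [Y] are dependent, an integer relation
    isolates a positive multiple [w' = n w] of some member [w] as an integer
    combination of the others.  Trading first trades [w] for [w'], since [w'] is a
    multiple of [w], and then the other members of the relation for [w'].  It
    stops when some member of the relation has disappeared, so that [Y] has fewer
    distinct vectors; neither kind of trade shrinks the real span.  By induction
    (lemma [decomposable_count]) the distinct vectors of [Y] may be assumed to
    form a basis [A] of the real space.  Then the coordinates [al i] of [x] along
    [A] are unique and [t_Y x] is the product of the binomial coefficients
    counting the ways to split [al i] among the copies of the [i]-th vector
    (lemma [partition_count_basis]).  Every copy number being positive, this is a
    polynomial in the coordinates, which are linear in [x].

    All this needs finite counts.  An infinite solution set would contain, by
    Dickson's lemma, two distinct comparable solutions, and their difference would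
    be a nontrivial nonnegative relation. *)

(** * Finiteness of the solution sets *)

(** Each index is taken to minimise [u] among all later ones; [a n] is such a
    minimiser over the indices at least [n]. *)
Lemma nondecreasing_subsequence (u : nat -> nat) :
  exists2 phi : nat -> nat, {homo phi : i j / (i < j)%N}
    & {homo u \o phi : i j / (i <= j)%N}.
Proof.
have argmin n : exists m,
    (n <= m)%N && `[< forall k, (n <= k)%N -> (u m <= u k)%N >].
  have /ex_minnP[v /asboolP[m nm <-] vmin] :
    exists v, `[< exists2 m, (n <= m)%N & u m = v >].
    by exists (u n); apply/asboolP; exists n.
  exists m; rewrite nm; apply/asboolP => k nk.
  by apply: vmin; apply/asboolP; exists k.
pose a n := xchoose (argmin n).
have leqa n : (n <= a n)%N by case/andP: (xchooseP (argmin n)).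
have a_min n k : (n <= k)%N -> (u (a n) <= u k)%N.
  by case/andP: (xchooseP (argmin n)) => _ /asboolP; exact.
exists (fun k => iter k (fun p => a p.+1) (a 0%N)).
  by apply: homo_ltn => [x y z|k]; [exact: ltn_trans|exact: leqa].
apply: homo_leq => [x|x y z|k /=]; [exact: leqnn|exact: leq_trans|].
case: k => [|k]; first exact: a_min.
by rewrite iterS; apply: a_min; apply: leq_trans (leqa _); apply: leqW; exact: leqa.
Qed.

(** Passing to subsequences one coordinate at a time makes all coordinates
    nondecreasing. *)
Lemma dickson (n : nat) (u : nat -> {ffun 'I_n -> nat}) :
  exists i j, (i < j)%N /\ forall k, (u i k <= u j k)%N.
Proof.
suff [phi phi_lt phi_le] : exists2 phi : nat -> nat,
    {homo phi : i j / (i < j)%N}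
    & forall k, k \in enum 'I_n -> {homo (fun i => u (phi i) k) : i j / (i <= j)%N}.
  exists (phi 0%N), (phi 1%N); split=> [|k]; first exact: phi_lt.
  by apply: phi_le; rewrite ?mem_enum.
elim: (enum 'I_n) => [|k s [phi phi_lt phi_le]]; first by exists id.
have [psi psi_lt psi_le] := nondecreasing_subsequence (fun i => u (phi i) k).
exists (phi \o psi) => [i j /psi_lt/phi_lt//|l].
rewrite inE => /predU1P[->//|/phi_le le_l i j ij].
apply: le_l; move: ij; rewrite leq_eqVlt => /predU1P[->//|/psi_lt].
exact: ltnW.
Qed.

(** The pointedness of [X] over the nonnegative integers, the only form of it
    that the counting arguments use. *)
Definition salient (s n : nat) (Y : n.-tuple 'rV[int]_s) : Prop :=
  forall beta : {ffun 'I_n -> nat},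
    \sum_(i < n) tnth Y i *+ beta i = 0 -> forall i, beta i = 0%N.

(** The difference of two comparable solutions solves the homogeneous equation,
    so distinct solutions form an antichain. *)
Lemma finite_solutions (s n : nat) (Y : n.-tuple 'rV[int]_s) x :
  salient Y -> finite_set (solutions Y x).
Proof.
move=> salY; apply/finite_setPn => /card_leP[f].
pose u k := val (f (exist _ k (mem_set I))).
have u_inj : injective u.
  move=> k l /val_inj/(@inj _ _ _ f)-/(_ (mem_set I) (mem_set I)).
  by case.
have u_sol k : \sum_(l < n) tnth Y l *+ u k l = x.
  exact: set_mem (valP (f (exist _ k (mem_set I)))).
have [i [j [lt_ij le_u]]] := dickson u.
have diff0 k : (u j k - u i k = 0)%N.
  rewrite -[LHS](ffunE (fun k => u j k - u i k)%N); apply: salY.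
  under eq_bigr => l _ do rewrite ffunE mulrnBr //.
  by rewrite sumrB !u_sol subrr.
suff /u_inj eq_ij : u i = u j by rewrite eq_ij ltnn in lt_ij.
apply/ffunP => k; apply/eqP; rewrite eqn_leq le_u /= -subn_eq0.
by rewrite diff0.
Qed.

(** * The recursion for the partition function *)

Lemma card_fset_set_image (T U : choiceType) (f : T -> U) (A : set T) :
  injective f -> finite_set A -> #|` fset_set (f @` A)%classic| = #|` fset_set A|.
Proof.
by move=> f_inj finA; rewrite fset_set_image // card_imfset.
Qed.

Lemma truncated_power_perm (s n m : nat) (Y : n.-tuple 'rV[int]_s)
    (Z : m.-tuple 'rV[int]_s) x :
  salient Z -> perm_eq Y Z -> truncated_power Y x = truncated_power Z x.
Proof.
move=> salZ eqYZ; have := perm_size eqYZ; rewrite !size_tuple => eq_nm.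
case: m / eq_nm Z salZ eqYZ => Z salZ /tuple_permP[p /val_inj ->].
pose f (beta : {ffun 'I_n -> nat}) := [ffun i => beta (p i)].
have f_inj : injective f.
  move=> b1 b2 /ffunP eq_f; apply/ffunP => i.
  by have := eq_f (p^-1%g i); rewrite !ffunE permKV.
have sum_perm (b : 'I_n -> nat) :
    \sum_i tnth Z i *+ b i = \sum_i tnth Z (p i) *+ b (p i).
  by rewrite (@reindex_inj _ _ _ _ p); last exact: perm_inj.
rewrite /truncated_power -(card_fset_set_image f_inj (finite_solutions x salZ)).
congr (#|` fset_set _|); apply/seteqP; split=> [b bx|_ [b bx <-]] /=.
  exists [ffun i => b (p^-1%g i)].
    move=> /=; rewrite -[RHS]bx; apply: etrans (sum_perm _) _.
    by apply: eq_bigr => i _; rewrite ffunE permK tnth_mktuple.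
  by apply/ffunP => i; rewrite !ffunE permK.
move=> /=; rewrite -[RHS]bx; apply: etrans (esym (sum_perm b)).
by apply: eq_bigr => i _; rewrite ffunE tnth_mktuple.
Qed.

(** Lists rather than tuples, so that vectors can be added, removed and permuted
    without casts on the length. *)
Definition partition_count (s : nat) (Y : seq 'rV[int]_s) : 'rV[int]_s -> nat :=
  truncated_power (in_tuple Y).

Lemma partition_count_perm s (Y Z : seq 'rV[int]_s) :
  salient (in_tuple Z) -> perm_eq Y Z -> partition_count Y =1 partition_count Z.
Proof. by move=> salZ eqYZ x; apply: truncated_power_perm. Qed.

(** A solution for [a :: Y] either ignores [a], and is a solution for [Y] padded
    by [put0], or uses [a], and comes by [incr0] from a solution for [x - a]. *)
Lemma partition_count_cons s a (Y : seq 'rV[int]_s) x :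
    salient (in_tuple (a :: Y)) -> salient (in_tuple Y) ->
  (partition_count (a :: Y) x
   = partition_count Y x + partition_count (a :: Y) (x - a)%R)%N.
Proof.
move=> salaY salY; rewrite /partition_count /truncated_power.
pose put0 (beta : {ffun 'I_(size Y) -> nat}) : {ffun 'I_(size (a :: Y)) -> nat} :=
  [ffun i : 'I_(size Y).+1 => if unlift ord0 i is Some j then beta j else 0%N].
pose incr0 (beta : {ffun 'I_(size (a :: Y)) -> nat}) :
    {ffun 'I_(size (a :: Y)) -> nat} :=
  [ffun i : 'I_(size Y).+1 => beta i + (i == ord0)]%N.
have put0_inj : injective put0.
  move=> b1 b2 /ffunP eq_b; apply/ffunP => j.
  by have := eq_b (lift ord0 j); rewrite !ffunE liftK.
have incr0_inj : injective incr0.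
  move=> b1 b2 /ffunP eq_b; apply/ffunP => i.
  by have := eq_b i; rewrite !ffunE => /addIn.
have sol_split b y : solutions (in_tuple (a :: Y)) y b =
    (a *+ b ord0 + \sum_(j < size Y) tnth (in_tuple Y) j *+ b (lift ord0 j) = y).
  rewrite /solutions /= big_ord_recl; congr (_ + _ = _).
  by apply: eq_bigr => j _; rewrite !(tnth_nth 0).
rewrite -(card_fset_set_image put0_inj (finite_solutions x salY)).
rewrite -(card_fset_set_image incr0_inj (finite_solutions (x - a) salaY)).
rewrite -cardfsUI -fset_setU; try by apply/finite_image/finite_solutions.
rewrite -fset_setI; try by apply/finite_image/finite_solutions.
have disj : (put0 @` solutions (in_tuple Y) x
    `&` incr0 @` solutions (in_tuple (a :: Y)) (x - a))%classic = set0.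
  apply/seteqP; split=> // b [[c1 _ <-] [c2 _]] /ffunP/(_ ord0).
  by rewrite !ffunE unlift_none eqxx addn1.
rewrite disj fset_set0 cardfs0 addn0; congr (#|` fset_set _|).
apply/seteqP; split=> [b|b [[c + <-]|[c + <-]]]; rewrite ?sol_split.
- case b0: (b ord0) => [|k] bx.
  + left; exists [ffun j => b (lift ord0 j)].
      move=> /=; rewrite -[RHS]bx mulr0n add0r.
      by apply: eq_bigr => j _; rewrite ffunE.
    apply/ffunP => i; rewrite ffunE.
    by case: unliftP => [j ->|->]; rewrite ?ffunE ?b0.
  + right; exists [ffun i => b i - (i == ord0)]%N.
      rewrite sol_split ffunE b0 subSS subn0 -bx mulrS addrAC.
      rewrite [a + _]addrC addrK; congr (_ + _).
      by apply: eq_bigr => j _; rewrite ffunE /= subn0.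
    apply/ffunP => i; rewrite !ffunE.
    by case: eqP => [->|_]; rewrite ?b0 ?subn0 ?addn0 // subnK.
- move=> cx; rewrite ffunE unlift_none mulr0n add0r -[RHS]cx.
  by apply: eq_bigr => j _; rewrite ffunE liftK.
- move=> cx; rewrite ffunE eqxx addn1 mulrSr addrAC.
  rewrite -[RHS](subrK a) -cx; congr (_ + _ + _).
  by apply: eq_bigr => j _; rewrite ffunE /= addn0.
Qed.

Lemma partition_count_nil s (x : 'rV[int]_s) :
  partition_count [::] x = (x == 0).
Proof.
rewrite /partition_count /truncated_power.
have [->|/eqP x0] := eqVneq x 0.
  rewrite (_ : solutions _ _ = [set [ffun=> 0%N]]%classic).
    by rewrite fset_set1 cardfs1.
  apply/seteqP; split=> b; rewrite /solutions /= ?big_ord0 //.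
  by move=> _; apply/ffunP => -[].
rewrite (_ : solutions _ _ = set0); first by rewrite fset_set0 cardfs0.
by apply/seteqP; split=> // b; rewrite /solutions /= big_ord0 => /esym.
Qed.

Lemma cone0 s n (A : n.-tuple 'rV[int]_s) : shifted_cone A 0 0.
Proof. by exists (fun=> 0%N); rewrite add0r big1. Qed.

Lemma coneD s n (A : n.-tuple 'rV[int]_s) u v :
  shifted_cone A 0 u -> shifted_cone A 0 v -> shifted_cone A 0 (u + v).
Proof.
move=> [al ->] [be ->]; exists (fun i => al i + be i)%N.
by rewrite !add0r -big_split /=; apply: eq_bigr => i _; rewrite mulrnDr.
Qed.

Lemma coneMn s n (A : n.-tuple 'rV[int]_s) u k :
  shifted_cone A 0 u -> shifted_cone A 0 (u *+ k).
Proof.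
by move=> Au; elim: k => [|k]; [exact: cone0|rewrite mulrS; exact: coneD].
Qed.

Lemma mem_cone s n (A : n.-tuple 'rV[int]_s) v : v \in A -> shifted_cone A 0 v.
Proof.
case/tnthP=> k ->; exists (fun j => (j == k) : nat).
rewrite add0r (bigD1 k) //= eqxx big1 ?addr0 // => j /negPf ->.
by rewrite mulr0n.
Qed.

(** The cone of a salient family contains no nonzero vector together with its
    opposite, whereas a vanishing combination involving a member of [Y] would put
    the opposite of that member in the cone. *)
Lemma salient_in_cone s n m (A : n.-tuple 'rV[int]_s)
    (Y : m.-tuple 'rV[int]_s) :
    salient A -> (forall v, v \in Y -> v != 0 /\ shifted_cone A 0 v) ->
  salient Y.
Proof.
move=> salA YA beta sum0 k.
case bk: (beta k) => [//|l]; have [Yk0 [al Yk]] := YA _ (mem_tnth k Y).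
case: (pselect (shifted_cone A 0 (- tnth Y k))) => [[be Nyk]|[]]; last first.
  move: sum0; rewrite (bigD1 k) //= bk mulrS -addrA => /eqP.
  rewrite addrC addr_eq0 => /eqP <-; apply: coneD.
    by apply: coneMn; exact: (YA _ (mem_tnth k Y)).2.
  apply: big_ind => [||i _]; [exact: cone0|exact: coneD|apply: coneMn].
  exact: (YA _ (mem_tnth i Y)).2.
move/eqP: Yk0; case; rewrite Yk add0r big1 // => i _.
suff -> : al i = 0%N by rewrite mulr0n.
suff /salA/(_ i)/eqP : \sum_(j < n) tnth A j *+ [ffun j => al j + be j]%N j = 0.
  by rewrite ffunE addn_eq0 => /andP[/eqP].
under eq_bigr => j _ do rewrite ffunE mulrnDr.
by rewrite big_split /= -[X in X + _]add0r -Yk -[X in _ + X]add0r -Nyk subrr.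
Qed.

Lemma partition_count_notin_cone s n (A : n.-tuple 'rV[int]_s) Y x :
  {subset Y <= A} -> ~ shifted_cone A 0 x -> partition_count Y x = 0%N.
Proof.
move=> sYA xA; rewrite /partition_count /truncated_power.
rewrite (_ : solutions _ _ = set0); first by rewrite fset_set0 cardfs0.
apply/seteqP; split=> // b /= bx; apply: xA; rewrite -bx.
apply: big_ind => [||i _]; [exact: cone0|exact: coneD|apply: coneMn].
by apply: mem_cone; apply: sYA; exact: mem_tnth.
Qed.

(** * Families supported on a basis *)

Definition nat_independent s n (A : n.-tuple 'rV[int]_s) : Prop :=
  forall al be : 'I_n -> nat,
    \sum_(i < n) tnth A i *+ al i = \sum_(i < n) tnth A i *+ be i -> al =1 be.

Lemma nat_independent_salient s n (A : n.-tuple 'rV[int]_s) :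
  nat_independent A -> salient A.
Proof.
move=> indA beta sum0; apply: (indA beta (fun=> 0%N)).
by rewrite sum0 big1.
Qed.

Lemma sum_delta s n (A : n.-tuple 'rV[int]_s) k (al : 'I_n -> nat) :
  \sum_(i < n) tnth A i *+ (al i + (i == k)) =
  \sum_(i < n) tnth A i *+ al i + tnth A k.
Proof.
under eq_bigr => i _ do rewrite mulrnDr.
rewrite big_split; congr (_ + _); rewrite /= (bigD1 k) //= eqxx big1 ?addr0 //.
by move=> i /negPf ->; rewrite mulr0n.
Qed.

Lemma nat_independent_uniq s n (A : n.-tuple 'rV[int]_s) :
  nat_independent A -> uniq A.
Proof.
move=> indA; apply/tuple_uniqP => i j eqA.
have := indA (fun k => 0 + (k == i))%N (fun k => 0 + (k == j))%N.
rewrite !sum_delta eqA => /(_ erefl i); rewrite eqxx.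
by case: eqP.
Qed.

(** With [e] copies of a vector, ['C((a + e).-1, a)] is the number of ways to
    write [a] as an ordered sum of [e] naturals.  The truncated predecessor makes
    this right at [e = 0] too: the value is [1] at [a = 0] and [0] elsewhere.
    Adding a copy of [A_k] to [Y] gives, by the recursion along [A_k],
    Pascal's rule in the [k]-th factor. *)
Lemma partition_count_basis s n (A : n.-tuple 'rV[int]_s) Y (al : 'I_n -> nat) :
    nat_independent A -> {subset Y <= A} ->
  partition_count Y (\sum_(i < n) tnth A i *+ al i) =
  (\prod_(i < n) 'C((al i + count_mem (tnth A i) Y).-1, al i))%N.
Proof.
move=> indA; have A_inj : injective (tnth A).
  exact/tuple_uniqP/nat_independent_uniq.
have A_neq0 v : v \in A -> v != 0.
  move=> /tnthP[k ->]; apply/eqP => Ak0.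
  have := indA (fun i => 0 + (i == k))%N (fun=> 0%N).
  by rewrite sum_delta Ak0 addr0 => /(_ erefl k); rewrite eqxx.
have sal Z : {subset Z <= A} -> salient (in_tuple Z).
  move=> sZA; apply: (salient_in_cone (nat_independent_salient indA)) => v vZ.
  by split; [exact/A_neq0/sZA|exact/mem_cone/sZA].
elim: Y al => [|a Y IHY] al sYA.
  rewrite partition_count_nil; have [/eqP|neq0] := boolP (_ == 0).
    move=> sum0; have al0 : al =1 fun=> 0%N by apply: indA; rewrite sum0 big1.
    by rewrite big1 // => i _; rewrite /= al0.
  apply/esym/eqP; rewrite -leqn0 leqNgt; apply: contra neq0.
  move=> /gt0_prodn factor_gt0; rewrite big1 // => i _.
  have := factor_gt0 i isT; rewrite addn0 bin_gt0; case: (al i) => [//|m] /=.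
  by rewrite ltnn.
have sYA' : {subset Y <= A} by move=> v vY; apply: sYA; rewrite inE vY orbT.
have /tnthP[k def_a] : a \in A by apply: sYA; rewrite mem_head.
have count_a i : count_mem (tnth A i) (a :: Y)
    = ((i == k) + count_mem (tnth A i) Y)%N.
  by rewrite /= def_a (inj_eq A_inj) eq_sym.
move: {2}(al k) (erefl (al k)) => m; elim: m al => [|m IHm] al al_k.
  rewrite partition_count_cons; try exact: sal.
  rewrite IHY // (partition_count_notin_cone sYA) ?addn0.
    apply: eq_bigr => i _; rewrite count_a; case: eqP => // ->.
    by rewrite al_k !bin0.
  case=> be; rewrite add0r => /(canRL (subrK _)); rewrite def_a -sum_delta.
  by move=> /indA/(_ k); rewrite al_k eqxx addn1.
pose al' i := (al i - (i == k))%N.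
have al'k : al' k = m by rewrite /al' al_k eqxx subSS subn0.
have al'_neq i : i != k -> al' i = al i by rewrite /al' => /negPf ->; rewrite subn0.
have -> : \sum_(i < n) tnth A i *+ al i = \sum_(i < n) tnth A i *+ al' i + a.
  rewrite def_a -sum_delta; apply: eq_bigr => i _; congr (_ *+ _).
  by have [->|/al'_neq ->] := eqVneq; rewrite ?al'k ?al_k ?addn1 ?addn0.
rewrite partition_count_cons; try exact: sal.
rewrite addrK (IHm _ al'k) [in partition_count Y _]def_a -sum_delta IHY //.
have split F : (\prod_(i < n) F i = F k * \prod_(i < n | i != k) F i)%N.
  by rewrite (bigD1 k).
pose P := (\prod_(i < n | i != k) 'C((al i + count_mem (tnth A i) Y).-1, al i))%N.
rewrite !split eqxx al_k al'k !count_a eqxx.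
rewrite (eq_bigr (P := fun i => i != k)
  (fun i => 'C((al i + count_mem (tnth A i) Y).-1, al i))) -/P; last first.
  by move=> i ik; rewrite al'_neq // (negPf ik) addn0.
rewrite [X in (_ + _ * X)%N](_ : _ = P); last first.
  by apply: eq_bigr => i ik; rewrite count_a al'_neq // (negPf ik).
rewrite [X in _ = (_ * X)%N](_ : _ = P); last first.
  by apply: eq_bigr => i ik; rewrite count_a (negPf ik).
by rewrite -mulnDl addn1 add1n !addnS addSn /= binS.
Qed.

(** * Sums of polynomials on shifted cones and the exchange step *)

Definition decomposable (R : realType) (s N : nat) (X : N.-tuple 'rV[int]_s)
    (f : 'rV[int]_s -> R) : Prop :=
  exists (r : nat) (g : 'I_r -> 'rV[int]_s -> R),
    (forall x, f x = \sum_(j < r) g j x) /\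
    (forall j, poly_on_shifted_sublattice_cone X (g j)).

Lemma decomposable_piece (R : realType) s N (X : N.-tuple 'rV[int]_s)
    (f : 'rV[int]_s -> R) :
  poly_on_shifted_sublattice_cone X f -> decomposable X f.
Proof.
by move=> Xf; exists 1%N, (fun=> f); split=> // x; rewrite big_ord1.
Qed.

Lemma decomposable0 (R : realType) s N (X : N.-tuple 'rV[int]_s) :
  decomposable X (fun=> 0 : R).
Proof. by exists 0%N, (fun _ _ => 0); split=> [x|[]//]; rewrite big_ord0. Qed.

Lemma decomposableD (R : realType) s N (X : N.-tuple 'rV[int]_s)
    (f g : 'rV[int]_s -> R) :
  decomposable X f -> decomposable X g -> decomposable X (fun x => f x + g x).
Proof.
move=> [r1 [f_ [fE Xf]]] [r2 [g_ [gE Xg]]].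
exists (r1 + r2)%N.
exists (fun j : 'I_(r1 + r2) =>
  match fintype.split j with inl i => f_ i | inr i => g_ i end).
split=> [x|j]; last by case: (fintype.split j).
rewrite big_split_ord fE gE; congr (_ + _); apply: eq_bigr => i _ /=.
  by rewrite (unsplitK (inl i)).
by rewrite (unsplitK (inr i)).
Qed.

Lemma decomposableN (R : realType) s N (X : N.-tuple 'rV[int]_s)
    (f : 'rV[int]_s -> R) :
  decomposable X f -> decomposable X (fun x => - f x).
Proof.
move=> [r [f_ [fE Xf]]]; exists r, (fun j x => - f_ j x); split=> [x|j].
  by rewrite fE sumrN.
have [A [c [p [XA freeA fin fout]]]] := Xf j.
exists A, c, (- p); split=> // x xA; last by rewrite fout ?oppr0.
by rewrite fin // /int_eval mevalN.
Qed.

Lemma decomposable_shift (R : realType) s N (X : N.-tuple 'rV[int]_s) c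
    (f : 'rV[int]_s -> R) :
  decomposable X f -> decomposable X (fun x => f (x - c)).
Proof.
move=> [r [f_ [fE Xf]]]; exists r, (fun j x => f_ j (x - c)); split=> [//|j].
have [A [c0 [p [XA freeA fin fout]]]] := Xf j.
have shiftA x : shifted_cone A (c0 + c) x <-> shifted_cone A c0 (x - c).
  split=> -[al]; first by move=> ->; exists al; rewrite addrAC addrK.
  by move=> /(canRL (subrK _)) ->; exists al; rewrite addrAC.
exists A, (c0 + c).
exists (p \mPo [tuple 'X_i - ((c 0 i)%:~R)%:MP | i < s]); split=> // x xA.
  rewrite fin; last exact/shiftA.
  rewrite /int_eval comp_mpoly_meval; apply: meval_eq => i.
  by rewrite tnth_mktuple mevalB mevalXU mevalC !mxE intrB.
by rewrite fout // => /shiftA.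
Qed.

Definition difference (R : realType) s (u : 'rV[int]_s) (f : 'rV[int]_s -> R) x :=
  f x - f (x - u).

(** The vectors [u] such that the difference of [f] along [u] is decomposable
    form a subgroup of the lattice. *)
Lemma decomposable_difference_comb (R : realType) s N (X : N.-tuple 'rV[int]_s)
    (f : 'rV[int]_s -> R) (V : seq 'rV[int]_s) (d : 'rV[int]_s -> int) :
    (forall v, v \in V -> d v != 0 -> decomposable X (difference v f)) ->
  decomposable X (difference (\sum_(v <- V) v *~ d v) f).
Proof.
move=> decV; pose G u := decomposable X (difference u f).
have G0 : G 0.
  rewrite /G (_ : difference 0 f = fun=> 0); first exact: decomposable0.
  by apply/funext => x; rewrite /difference subr0 subrr.
have GD u v : G u -> G v -> G (u + v).
  move=> Gu /(decomposable_shift u)/(decomposableD Gu); congr decomposable.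
  by apply/funext => x; rewrite /difference opprD addrA [RHS]addrC addrA subrK addrC.
have GN u : G u -> G (- u).
  move=> /(decomposable_shift (- u))/decomposableN; congr decomposable.
  by apply/funext => x; rewrite /difference opprB !opprK addrK.
have GMn u n : G u -> G (u *+ n).
  by move=> Gu; elim: n => [|n]; [exact: G0|rewrite mulrS; exact: GD].
rewrite -/(G _) big_seq; apply: big_ind => // v vV.
have [->|dv0] := eqVneq (d v) 0; first by rewrite mulr0z.
have Gv := decV v vV dv0.
case: (d v) => n; first exact: GMn.
by rewrite NegzE mulrNz; apply/GN/GMn.
Qed.

Definition nonzero_multiples s N (X : N.-tuple 'rV[int]_s)
    (Y : seq 'rV[int]_s) : Prop :=
  forall v, v \in Y -> v != 0 /\ nat_multiples X v.

Lemma nonzero_multiples_salient s N (X : N.-tuple 'rV[int]_s) Y :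
  salient X -> nonzero_multiples X Y -> salient (in_tuple Y).
Proof.
move=> salX admY; apply: (salient_in_cone salX) => v /admY[v0 [a aX [n def_v]]].
by split=> //; rewrite def_v; apply/coneMn/mem_cone.
Qed.

Definition real_count (R : realType) s (Y : seq 'rV[int]_s) x : R :=
  (partition_count Y x)%:R.

Lemma difference_real_count (R : realType) s N (X : N.-tuple 'rV[int]_s) v Y :
    salient X -> nonzero_multiples X (v :: Y) ->
  difference v (@real_count R s (v :: Y)) = real_count R Y.
Proof.
move=> salX admvY; apply/funext => x; rewrite /difference /real_count.
rewrite partition_count_cons ?natrD ?addrK //;
  apply: (nonzero_multiples_salient salX) => //.
by move=> w wY; apply: admvY; rewrite inE wY orbT.
Qed.

(** Since [Y] is [u :: Y] without [u], its count is the difference along [u] of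
    the count of [u :: Y]; the difference of the latter along a member [v] of [Y]
    is the count of [u :: rem v Y].  The relation expressing [u] through [V]
    transfers decomposability from these latter differences to the former. *)
Lemma exchange (R : realType) s N (X : N.-tuple 'rV[int]_s)
    (Y V : seq 'rV[int]_s) u (d : 'rV[int]_s -> int) :
    salient X -> nonzero_multiples X (u :: Y) -> u = \sum_(v <- V) v *~ d v ->
    (forall v, v \in V -> d v != 0 -> v \in Y) ->
    (forall v, v \in V -> d v != 0 ->
       decomposable X (real_count R (u :: rem v Y))) ->
  decomposable X (real_count R Y).
Proof.
move=> salX admuY def_u VY decV; rewrite -(difference_real_count R salX admuY).
rewrite [u in difference u]def_u; apply: decomposable_difference_comb => v vV dv.
have eqY : perm_eq (u :: Y) (v :: u :: rem v Y).
  apply: (@perm_trans _ (u :: v :: rem v Y)).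
    by rewrite perm_cons perm_to_rem // VY.
  by have /permPl := perm_catCA [:: u] [:: v] (rem v Y); exact.
have adm : nonzero_multiples X (v :: u :: rem v Y).
  by move=> w; rewrite -(perm_mem eqY); exact: admuY.
rewrite (_ : real_count R (u :: Y) = real_count R (v :: u :: rem v Y)).
  by rewrite (difference_real_count R salX adm); exact: decV.
apply/funext => x; congr (_%:R); apply: partition_count_perm => //.
exact: nonzero_multiples_salient adm.
Qed.

(** The rank of an integer matrix is the same over the rationals and the reals,
    and denominators can be cleared in a rational relation. *)
Lemma integer_relation (R : realType) s (U : seq 'rV[int]_s) :
    uniq U -> ~~ free [seq real_vec R v | v <- U] ->
  exists w n d,
    [/\ w \in U, (0 < n)%N & w *+ n = \sum_(v <- rem w U) v *~ d v].
Proof.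
move=> uniqU notfree; pose n := size U.
pose M (F : fieldType) : 'M[F]_(n, s) :=
  \matrix_(i, j) (tnth (in_tuple U) i 0 j)%:~R.
have : ~~ row_free (M rat).
  apply: contra notfree => freeM.
  have freeMR : row_free (M R).
    rewrite (_ : M R = map_mx ratr (M rat)) ?row_free_map //.
    by apply/matrixP => i j; rewrite !mxE ratr_int.
  suff : free (map_tuple (@real_vec R s) (in_tuple U)) by [].
  apply/freeP => k sum0 i.
  have : (\row_i k i) *m M R = 0.
    apply/rowP => j; rewrite !mxE; move/rowP/(_ j): sum0; rewrite !mxE summxE => sum0.
    rewrite -[RHS]sum0; apply: eq_bigr => l _.
    by rewrite !mxE -tnth_nth tnth_map mxE.
  rewrite -(mul0mx _ (M R)) => /(row_free_inj freeMR)/rowP/(_ i).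
  by rewrite !mxE.
rewrite -kermx_eq0 => /rowV0Pn[k /sub_kermxP kM0 k0].
have [i0 ki0] : exists i, k 0 i != 0.
  apply/existsP; apply: contraR k0; rewrite negb_exists => /forallP k_eq0.
  by apply/eqP/rowP => i; have /negPn/eqP := k_eq0 i; rewrite mxE.
(* Multiplying by the product of all denominators clears them. *)
pose c i : int := numq (k 0 i) * \prod_(j < n | j != i) denq (k 0 j).
pose D : rat := (\prod_(j < n) denq (k 0 j))%:~R.
have cE i : (c i)%:~R = k 0 i * D.
  by rewrite /D (bigD1 i) //= /c !intrM numqE mulrA.
have c_rel : \sum_(i < n) tnth (in_tuple U) i *~ c i = 0.
  apply/rowP => j; rewrite summxE mxE; apply: (@intr_inj rat).
  rewrite rmorph_sum /=.
  have /rowP/(_ j) := kM0; rewrite !mxE => /(congr1 (fun t => t * D)).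
  rewrite mul0r mulr_suml => kM0D; rewrite -[RHS]kM0D; apply: eq_bigr => i _.
  by rewrite !mxE mulrAC -cE -scaler_int intz mxE intrM.
pose sg := Num.sg (c i0).
pose d v : int := if insub (index v U) is Some i then - (sg * c i) else 0.
have dE i : d (tnth (in_tuple U) i) = - (sg * c i).
  rewrite /d (tnth_nth 0) index_uniq //.
  by case: insubP => [j _ /val_inj->|]; rewrite ?ltn_ord.
have U_i0 := mem_tnth i0 (in_tuple U).
(* The sign of the coefficient of [w] is absorbed in [d]. *)
exists (tnth (in_tuple U) i0), `|c i0|%N, d; split=> //.
  rewrite absz_gt0 -(intr_eq0 rat) cE mulf_neq0 // intr_eq0.
  by apply/prodf_neq0 => j _; exact: denq_neq0.
have : \sum_(v <- U) v *~ d v = 0.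
  rewrite (big_tnth _ _ U).
  transitivity (- ((\sum_i tnth (in_tuple U) i *~ c i) *~ sg)).
    rewrite mulrz_suml -sumrN; apply: eq_bigr => i _.
    by rewrite dE mulrNz mulrC mulrzA.
  by rewrite c_rel mul0rz oppr0.
rewrite (big_rem _ U_i0) /= dE mulrNz addrC => /eqP; rewrite subr_eq0 => /eqP ->.
by rewrite -normrEsg -abszE.
Qed.

(** * The independent case *)

Lemma bin_fact_prod a k : ('C(a + k, a) * k`! = \prod_(j < k) (a + j.+1))%N.
Proof.
elim: k => [|k IHk]; first by rewrite addn0 binn big_ord0.
rewrite big_ord_recr -IHk factS mulnA [RHS]mulnAC /=; congr (_ * _)%N.
have := mul_bin_down (a + k.+1) a; rewrite addKn addnS /= => mul_bin.
by rewrite mulnC -mul_bin mulnC.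
Qed.

(** The binomial coefficient ['C(L + k, k)] as a polynomial in [L]. *)
Definition rising_poly (R : realType) s (L : {mpoly R[s]}) k : {mpoly R[s]} :=
  (k`!%:R)^-1 *: \prod_(j < k) (L + (j.+1%:R)%:MP).

Lemma meval_rising_poly (R : realType) s (L : {mpoly R[s]}) k v a :
  L.@[v] = a%:R -> (rising_poly L k).@[v] = 'C(a + k, a)%:R.
Proof.
move=> La; rewrite /rising_poly mevalZ rmorph_prod /=.
under eq_bigr => j _ do rewrite mevalD La mevalC -natrD.
rewrite -natr_prod -bin_fact_prod natrM mulrC mulfK //.
by rewrite pnatr_eq0 -lt0n fact_gt0.
Qed.

Lemma real_vec_comb (R : realType) s n (A : n.-tuple 'rV[int]_s)
    (al : 'I_n -> nat) :
  real_vec R (\sum_(i < n) tnth A i *+ al i)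
  = \sum_(i < n) (al i)%:R *: real_vec R (tnth A i).
Proof.
rewrite /real_vec raddf_sum; apply: eq_bigr => i _.
by rewrite raddfMn scaler_nat.
Qed.

Lemma free_nat_independent (R : realType) s n (A : n.-tuple 'rV[int]_s) :
  free [seq real_vec R v | v <- A] -> nat_independent A.
Proof.
move=> freeA al be /(congr1 (@real_vec R s)); rewrite !real_vec_comb.
move=> /eqP; rewrite -subr_eq0 -sumrB => /eqP sum0 i.
have /freeP freeT : free (map_tuple (@real_vec R s) A) by [].
apply/eqP; rewrite -(eqr_nat R) -subr_eq0; apply/eqP.
apply: (freeT (fun i => (al i)%:R - (be i)%:R)).
rewrite -[RHS]sum0; apply: eq_bigr => j _.
by rewrite -tnth_nth tnth_map scalerBl.
Qed.

(** The distinct vectors of [Y] form a basis [A], so [partition_count_basis]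
    applies on the cone of [A].  Each vector of [A] occurs in [Y], and a positive
    copy number is what makes the binomial coefficient polynomial. *)
Lemma poly_on_basis (R : realType) s N (X : N.-tuple 'rV[int]_s) Y :
    nonzero_multiples X Y -> free [seq real_vec R v | v <- undup Y] ->
    (<<[seq real_vec R v | v <- Y]>> = fullv)%VS ->
  poly_on_shifted_sublattice_cone X (real_count R Y).
Proof.
move=> admY freeU spanY.
have spanU : (<<[seq real_vec R v | v <- undup Y]>> = fullv)%VS.
  rewrite -spanY; apply: eq_span => v.
  by apply/mapP/mapP => -[w wY ->]; exists w; rewrite ?mem_undup // -mem_undup.
have sizeU : size (undup Y) == s.
  by move: freeU; rewrite /free spanU dimvf /dim /= mul1n size_map eq_sym.
pose A : s.-tuple 'rV[int]_s := Tuple sizeU.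
have indA : nat_independent A := free_nat_independent (A := A) freeU.
pose M : 'M[R]_s := \matrix_(i, j) real_vec R (tnth A i) 0 j.
have unitM : M \in unitmx.
  have /freeP freeT : free (map_tuple (@real_vec R s) A) by [].
  rewrite -row_free_unit -kermx_eq0; apply/rowV0P => k /sub_kermxP kM.
  apply/rowP => i; rewrite [RHS]mxE; move: i; apply: (freeT (fun i => k 0 i)).
  rewrite -[RHS]kM; apply/rowP => j; rewrite summxE mxE; apply: eq_bigr => l _.
  by rewrite -tnth_nth tnth_map !mxE.
pose coef i : {mpoly R[s]} := \sum_(k < s) invmx M k i *: 'X_k.
have coefE i al : (coef i).@[fun j => ((\sum_(l < s) tnth A l *+ al l) 0 j)%:~R]
    = (al i)%:R.
  have <- : (real_vec R (\sum_(l < s) tnth A l *+ al l) *m invmx M) 0 i = (al i)%:R.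
    suff -> : real_vec R (\sum_(l < s) tnth A l *+ al l) = (\row_l (al l)%:R) *m M.
      by rewrite mulmxK // mxE.
    rewrite real_vec_comb; apply/rowP => j; rewrite summxE mxE.
    by apply: eq_bigr => l _; rewrite !mxE.
  rewrite /coef mxE rmorph_sum /=; apply: eq_bigr => k _.
  by rewrite mevalZ mevalXU [in RHS]mxE mulrC.
pose e i := (count_mem (tnth A i) Y).-1.
exists A, 0, (\prod_(i < s) rising_poly (coef i) (e i)).
have A_Y v : (v \in A) = (v \in Y) by rewrite -(mem_undup Y).
split=> // [v|x [al]|x xA].
- by rewrite A_Y => /admY[].
- rewrite add0r => ->; rewrite /real_count (partition_count_basis _ indA).
    rewrite natr_prod /int_eval rmorph_prod /=; apply: eq_bigr => i _.
    rewrite (meval_rising_poly _ (coefE i al)).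
    have : (0 < count_mem (tnth A i) Y)%N.
      by rewrite -has_count has_pred1 -A_Y mem_tnth.
    by rewrite /e; case: count => // k _; rewrite addnS.
  by move=> v; rewrite A_Y.
- rewrite /real_count (partition_count_notin_cone _ xA) // => v.
  by rewrite A_Y.
Qed.

(** * Descent on the number of distinct vectors *)

Lemma span_full_trans (R : realType) s (Y Z : seq 'rV[int]_s) :
    (<<[seq real_vec R v | v <- Y]>> = fullv)%VS ->
    (forall v, v \in Y -> real_vec R v \in <<[seq real_vec R w | w <- Z]>>%VS) ->
  (<<[seq real_vec R v | v <- Z]>> = fullv)%VS.
Proof.
move=> spanY YZ; apply/eqP; rewrite eqEsubv subvf -spanY.
by apply/span_subvP => _ /mapP[v vY ->]; exact: YZ.
Qed.

(** The outer induction is on the number of distinct vectors of [Y].  The inner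
    one runs over the lists [Z] reached by trading and decreases the number of
    members other than [w'], since each trade replaces one of them by [w'].  If
    [w'] is another of the distinct vectors of [Y], the elimination of [w] alone
    lowers their number; otherwise [Z] stays as large only as long as it
    contains every member of the relation. *)
Lemma decomposable_count (R : realType) s N (X : N.-tuple 'rV[int]_s) Y :
    salient X -> nonzero_multiples X Y ->
    (<<[seq real_vec R v | v <- Y]>> = fullv)%VS ->
  decomposable X (real_count R Y).
Proof.
move=> salX; have [m] := ubnP (size (undup Y)).
elim: m Y => // m IHm Y ltYm admY spanY.
set U := undup Y; have uniqU : uniq U := undup_uniq Y.
have [freeU|/(integer_relation uniqU)] := boolP (free [seq real_vec R v | v <- U]).
  exact/decomposable_piece/poly_on_basis.
move=> [w [n [d [wU n_gt0 rel]]]]; set w' := w *+ n in rel.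
have [w_neq0 [a aX [p def_w]]] : w != 0 /\ nat_multiples X w.
  by apply: admY; rewrite -mem_undup.
have w'_ok : w' != 0 /\ nat_multiples X w'.
  split; last by exists a => //; exists (p * n)%N; rewrite /w' def_w mulrnA.
  apply: contra w_neq0 => /eqP/rowP w'0; apply/eqP/rowP => j.
  move/(_ j)/eqP: w'0; rewrite /w' mulmxnE !mxE mulrn_eq0 eqn0Ngt n_gt0.
  by move/eqP.
have rem_w'_adm v Z : nonzero_multiples X Z -> nonzero_multiples X (w' :: rem v Z).
  by move=> admZ y; rewrite inE => /predU1P[->|/mem_rem/admZ].
have real_w' : real_vec R w' = n%:R *: real_vec R w.
  by rewrite /real_vec /w' raddfMn scaler_nat.
suff inner k Z : (count (predC1 w') Z < k)%N -> {subset Z <= w' :: U} ->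
    nonzero_multiples X Z -> (<<[seq real_vec R v | v <- Z]>> = fullv)%VS ->
    decomposable X (real_count R Z).
  apply: (inner (size Y).+1) => // [|v vY]; first by rewrite ltnS count_size.
  by rewrite inE mem_undup vY orbT.
elim: k Z => // k IHk Z ltZk subZ admZ spanZ.
(* As soon as a distinct vector has been lost, the outer induction takes over. *)
have [ltZU|leUZ] := ltnP (size (undup Z)) (size U).
  by apply: IHm => //; apply: leq_trans ltZU _.
have replace v : v \in Z -> v != w' ->
    real_vec R v \in <<[seq real_vec R y | y <- w' :: rem v Z]>>%VS ->
    decomposable X (real_count R (w' :: rem v Z)).
  move=> vZ v_neq span_v; apply: IHk.
  - rewrite /= eqxx add0n count_rem vZ /= v_neq.
    have : (0 < count (predC1 w') Z)%N by rewrite -has_count; apply/hasP; exists v.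
    by move: ltZk; case: count => // c; rewrite subn1.
  - by move=> y; rewrite inE => /predU1P[->|/mem_rem/subZ//]; rewrite mem_head.
  - exact: rem_w'_adm.
  - apply: span_full_trans spanZ _ => y.
    rewrite (perm_mem (perm_to_rem vZ)) inE => /predU1P[->//|yZ].
    by apply/memv_span/map_f; rewrite inE yZ orbT.
have adm_w'Z : nonzero_multiples X (w' :: Z).
  by move=> y; rewrite inE => /predU1P[->|/admZ].
(* Copies of [w] are traded first, along the relation [w' = n w]. *)
have [/andP[wZ w_neq]|w_notin] := boolP ((w \in Z) && (w != w')).
  apply: (@exchange R _ _ X Z [:: w] w' (fun=> n)) => //.
  - by rewrite big_seq1.
  - by move=> v; rewrite inE => /eqP ->.
  - move=> v; rewrite inE => /eqP -> _; apply: replace => //.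
    rewrite -[real_vec R w](@scalerK _ _ n%:R) ?pnatr_eq0 -?lt0n //.
    by rewrite -real_w'; apply/memvZ/memv_span/map_f; rewrite mem_head.
(* Now [Z] lies in [w' :: rem w U], and it has at least as many distinct
   vectors, so the two have the same members and [w'] is not in [rem w U]. *)
have subZ' : {subset undup Z <= w' :: rem w U}.
  move=> z; rewrite mem_undup => zZ; have := subZ z zZ.
  rewrite !inE => /predU1P[->|zU]; first by rewrite eqxx.
  rewrite (mem_rem_uniq w uniqU) !inE zU andbT.
  have [eq_zw|//] := eqVneq z w; rewrite ?orbT // orbF.
  by move: w_notin; rewrite -eq_zw zZ negbK.
have size_rem' : (size (w' :: rem w U) <= size (undup Z))%N.
  by rewrite /= size_rem // prednK // lt0n size_eq0; case: (U) wU.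
have /andP[w'_notin _] : uniq (w' :: rem w U).
  exact: leq_size_uniq (undup_uniq Z) subZ' size_rem'.
have [_ eqZ] := uniq_min_size (undup_uniq Z) subZ' size_rem'.
have remZ v : v \in rem w U -> v \in Z.
  by move=> vU; rewrite -mem_undup eqZ inE vU orbT.
apply: (exchange salX adm_w'Z rel) => v vU dv; first exact: remZ.
have v_neq : v != w' by apply: contraNneq w'_notin => <-.
apply: replace => //; first exact: remZ.
have uniq_rem := rem_uniq w uniqU.
(* The vector traded away is recovered from [w'] and the rest of the relation. *)
have : real_vec R v *~ d v
    = real_vec R w' - \sum_(y <- rem v (rem w U)) real_vec R y *~ d y.
  rewrite rel (big_rem _ vU) /= /real_vec raddfD raddf_sum raddfMz /=.
  rewrite -[LHS]addr0 -addrA; congr (_ + _); apply/esym/eqP; rewrite subr_eq0.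
  by apply/eqP/eq_bigr => y _; rewrite raddfMz.
rewrite -scaler_int => def_v.
rewrite -[real_vec R v](@scalerK _ _ (d v)%:~R) ?intr_eq0 // def_v.
apply/memvZ/memvB; first by apply/memv_span/map_f; rewrite mem_head.
rewrite big_seq; apply: memv_suml => y.
rewrite (mem_rem_uniq v uniq_rem) !inE => /andP[y_neq yU].
rewrite -scaler_int; apply/memvZ/memv_span/map_f.
have := remZ y yU.
rewrite (perm_mem (perm_to_rem (remZ v vU))) !inE (negPf y_neq) /=.
by move=> ->; rewrite orbT.
Qed.

Lemma pointed_salient (R : realType) s N (X : N.-tuple 'rV[int]_s) :
    (forall x : 'I_N -> R, (forall i, 0 <= x i) ->
       \sum_(i < N) x i *: real_vec R (tnth X i) = 0 -> forall i, x i = 0) ->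
  salient X.
Proof.
move=> X_pointed beta sum0 i; apply/eqP; rewrite -(eqr_nat R); apply/eqP.
apply: (X_pointed (fun i => (beta i)%:R)) => [j|]; first exact: ler0n.
by rewrite -real_vec_comb sum0 /real_vec raddf0.
Qed.

Theorem theorem6 (R : realType) (s N : nat) (X : N.-tuple 'rV[int]_s)
    (s_ge1 : (1 <= s)%N)
    (X_neq0 : forall a, a \in X -> a != 0)
    (X_spans : (<<[seq real_vec R a | a <- X]>> = fullv)%VS)
    (X_pointed : forall x : 'I_N -> R,
        (forall i, 0 <= x i) ->
        \sum_(i < N) x i *: real_vec R (tnth X i) = 0 ->
        forall i, x i = 0) :
  exists (r : nat) (f : 'I_r -> 'rV[int]_s -> R),
    (forall x, (truncated_power X x)%:R = \sum_(j < r) f j x) /\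
    (forall j, poly_on_shifted_sublattice_cone X (f j)).
Proof.
have salX := pointed_salient X_pointed.
have admX : nonzero_multiples X X.
  by move=> v vX; split; [exact: X_neq0|exists v => //; exists 1%N].
have [r [f [fE Xf]]] := decomposable_count salX admX X_spans.
exists r, f; split=> // x; rewrite -fE /real_count /partition_count.
congr (_%:R); apply: truncated_power_perm => //.
exact: (nonzero_multiples_salient salX).
Qed.
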